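(* Let $t\ge 2$, $k>t$, and $\ell\ge 1$ be integers. If a $\mathsf{PHHF}(t;k,(v_1,\dots,v_t),t)$ exists, then a $\mathsf{PHHF}(t+1;\ell k,(\ell v_1,\dots,\ell v_t,k),t+1)$ exists. Moreover, if a fractal $\mathsf{PHHF}(t;k,(v_1,\dots,v_t),t)$ exists, then a fractal $\mathsf{PHHF}(t+1;\ell k,(\ell v_1,\dots,\ell v_t,k),t+1)$ exists.
   Context: An $\mathsf{HHF}(N;k,(w_1,\dots,w_N))$ is an $N\times k$ array in which row $i$ contains at most $w_i$ distinct symbols. Given a set $S$ of columns and a partition of $S$ into $p$ classes (some possibly empty), a row $r$ separates it if any two columns in distinct classes have distinct entries in row $r$. A $\mathsf{DHHF}(N;k,(w_1,\dots,w_N),t,p)$ is an $\mathsf{HHF}(N;k,(w_1,\dots,w_N))$ in which every partition of every $t$-set of columns into $p$ classes is separated by some row. A $\mathsf{PHHF}(N;k,(w_1,\dots,w_N),t)$ is a $\mathsf{DHHF}(N;k,(w_1,\dots,w_N),t,t)$, i.e. every $t$-set of columns has a row in which its $t$ entries are distinct. A $\mathsf{DHHF}(t;k,(v_1,\dots,v_t),t,p)$ is fractal if $t\le 2$, or if for each row $j$, deleting row $j$ yields a fractal $\mathsf{DHHF}(t-1;k,(v_1,\dots,v_{j-1},v_{j+1},\dots,v_t),t-1,\min(p,t-1))$; a fractal $\mathsf{PHHF}$ is a fractal $\mathsf{DHHF}$ with $p=t$. *)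

(* Defs.v *)
From mathcomp Require Import all_boot all_order all_algebra.

Set Implicit Arguments.
Unset Strict Implicit.
Unset Printing Implicit Defensive.

(* Arrays have entries in [nat]: only equality of entries within a row
   matters, and each row has finitely many entries. *)
Definition HHF N k (w : N.-tuple nat) (A : 'M[nat]_(N, k)) : Prop :=
  forall i : 'I_N, size (undup [seq A i x | x : 'I_k]) <= tnth w i.

(* The classes are indexed by ['I_p] and may be empty. *)
Definition is_partition_into k p (S : {set 'I_k}) (P : 'I_p -> {set 'I_k}) :
    Prop :=
  (forall c d : 'I_p, c != d -> [disjoint P c & P d]) /\
  \bigcup_(c < p) P c = S.

Definition separates N k p (A : 'M[nat]_(N, k)) (r : 'I_N)
    (P : 'I_p -> {set 'I_k}) : Prop :=
  forall (c d : 'I_p) (x y : 'I_k),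
    c != d -> x \in P c -> y \in P d -> A r x != A r y.

Definition DHHF N k (w : N.-tuple nat) (t p : nat) (A : 'M[nat]_(N, k)) : Prop :=
  HHF w A /\
  forall (S : {set 'I_k}) (P : 'I_p -> {set 'I_k}),
    #|S| = t -> is_partition_into S P -> exists r : 'I_N, separates A r P.

Definition PHHF N k (w : N.-tuple nat) (t : nat) (A : 'M[nat]_(N, k)) : Prop :=
  DHHF w t t A.

Definition tuple_delete n (T : Type) (j : 'I_n) (w : n.-tuple T) :
    n.-1.-tuple T :=
  [tuple tnth w (lift j i) | i < n.-1].

(* The strength is the number [t] of rows. *)
Fixpoint fractal_DHHF t k :
    t.-tuple nat -> nat -> 'M[nat]_(t, k) -> Prop :=
  match t return t.-tuple nat -> nat -> 'M[nat]_(t, k) -> Prop with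
  | 0 => fun v p A => DHHF v 0 p A
  | t'.+1 => fun v p A =>
      DHHF v t'.+1 p A /\
      (t'.+1 <= 2 \/
       forall j : 'I_t'.+1,
         fractal_DHHF (tuple_delete j v) (minn p t') (row' j A))
  end.

Definition fractal_PHHF t k (v : t.-tuple nat) (A : 'M[nat]_(t, k)) : Prop :=
  fractal_DHHF v t A.

(* Main.v *)
(* Index the columns of the new array by pairs (x, y), with x a column of [A]
   and y < l.  The last row reads x and row i reads (A i x, y).  A set of t + 1
   columns with distinct x-coordinates is separated by the last row; otherwise
   the x-coordinates lie in a t-set of columns of [A], and the row separating
   that t-set separates the original columns, since two of them with the same x
   have distinct y.  Deleting a row of the new array either drops the last row,
   or yields the same construction applied to [A] with a row deleted, whence
   fractality. *)
Require Import Defs.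
From mathcomp Require Import all_boot all_order all_algebra.

Set Implicit Arguments.
Unset Strict Implicit.
Unset Printing Implicit Defensive.

Definition perfect N k (t : nat) (A : 'M[nat]_(N, k)) : Prop :=
  forall S : {set 'I_k}, #|S| = t -> exists r : 'I_N, {in S &, injective (A r)}.

Lemma PHHFP N k (w : N.-tuple nat) t (A : 'M[nat]_(N, k)) :
  PHHF w t A <-> HHF w A /\ perfect t A.
Proof.
split=> -[wA sepA]; split=> //.
  move=> S St; move: sepA; rewrite -{t}St.
  (* With as many classes as elements of [S], each class can be a singleton. A row separating these
     singletons is injective on [S]. *)
  move=> /(_ S (fun c => [set enum_val c]) erefl) [].
    split=> [c d neq_cd|].
      by rewrite disjoints1 inE (inj_eq enum_val_inj).
    apply/setP=> x; apply/bigcupP/idP => [[c _]|xS].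
      by rewrite inE => /eqP->; apply: enum_valP.
    by exists (enum_rank_in xS x); rewrite // inE enum_rankK_in.
  move=> r sep_r; exists r => x y xS yS eq_xy; apply/eqP/negPn/negP=> neq_xy.
  have /negP[] : A r x != A r y; last by apply/eqP.
  apply: (sep_r (enum_rank_in xS x) (enum_rank_in yS y)).
  - apply: contra neq_xy => /eqP eq_rk.
    by rewrite -(enum_rankK_in xS xS) eq_rk (enum_rankK_in yS yS).
  - by rewrite inE enum_rankK_in.
  - by rewrite inE enum_rankK_in.
move=> S P St [disjP coverP]; have [r inj_r] := sepA S St.
exists r => c d x y neq_cd xc yd; apply/eqP=> eq_xy.
have xS : x \in S by rewrite -coverP; apply/bigcupP; exists c.
have yS : y \in S by rewrite -coverP; apply/bigcupP; exists d.
move: yd; rewrite -(inj_r _ _ xS yS eq_xy).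
by rewrite (disjointFr (disjP c d neq_cd) xc).
Qed.

Lemma superset_of_card (T : finType) (U : {set T}) n :
  #|U| <= n <= #|T| -> exists2 S : {set T}, U \subset S & #|S| = n.
Proof.
elim: n => [|n IHn] /andP[leUn lenT].
  by exists U => //; apply/eqP; rewrite -leqn0.
move: leUn; rewrite leq_eqVlt => /orP[/eqP Un|ltUn]; first by exists U.
have [|S US Sn] := IHn; first by rewrite -ltnS ltUn ltnW.
have : 0 < #|~: S| by rewrite cardsCs setCK Sn subn_gt0.
case/card_gt0P=> x; rewrite inE => xS; exists (x |: S).
  exact: subset_trans US (subsetUr _ _).
by rewrite cardsU1 xS Sn.
Qed.

Lemma HHF_delete N k (w : N.-tuple nat) (A : 'M[nat]_(N, k)) (j : 'I_N) :
  HHF w A -> HHF (tuple_delete j w) (row' j A).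
Proof.
move=> wA i; rewrite tnth_mktuple.
by rewrite (eq_image (fun=> erefl) (fun x => mxE _ _ i x)); apply: wA.
Qed.

(** With at least three rows this is the recursive clause of fractality. With two rows that clause
    may be absent, but the remaining row trivially separates any single column. *)
Lemma fractal_PHHF_delete t k (v : t.+2.-tuple nat) (A : 'M[nat]_(t.+2, k)) j :
  fractal_PHHF v A -> fractal_PHHF (tuple_delete j v) (row' j A).
Proof.
case=> -[vA _] [|/(_ j)]; last by rewrite (minn_idPr (leqnSn _)).
case: t => // in v A j vA * => _; split; last by left.
apply/PHHFP; split; first exact: HHF_delete j vA.
move=> S /eqP/cards1P[z ->]; exists ord0 => x y.
by rewrite !inE => /eqP-> /eqP->.
Qed.

Section Construction.

Variables (k l : nat) (l_gt0 : 0 < l).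

Lemma col_base_subproof (c : 'I_(l * k)) : c %/ l < k.
Proof. by rewrite ltn_divLR // [k * l]mulnC. Qed.

(** Column [c] stands for the pair ([c %/ l], [c %% l]); this is its x-coordinate. *)
Definition col_base (c : 'I_(l * k)) : 'I_k := Ordinal (col_base_subproof c).

(* The pair (a, y) with y < l is encoded as a * l + y. *)
Definition inflate N (A : 'M[nat]_(N, k)) : 'M[nat]_(N, l * k) :=
  \matrix_(i, c) (A i (col_base c) * l + c %% l).

Definition extend N (A : 'M[nat]_(N, k)) : 'M[nat]_(N.+1, l * k) :=
  \matrix_(i, c)
    if unlift ord_max i is Some i' then inflate A i' c else col_base c.

Definition inflate_width N (v : N.-tuple nat) : N.-tuple nat :=
  [tuple l * tnth v i | i < N].

Definition extend_width N (v : N.-tuple nat) : N.+1.-tuple nat :=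
  [tuple if unlift ord_max i is Some i' then l * tnth v i' else k | i < N.+1].

(** The [unlift] form commutes with row deletion; the [rcons] form is the one in the theorem. *)
Lemma extend_widthE N (v : N.-tuple nat) :
  extend_width v = [tuple of rcons (map (muln l) v) k].
Proof.
apply: eq_from_tnth => i; rewrite tnth_mktuple (tnth_nth 0) /= nth_rcons.
rewrite size_map size_tuple; case: unliftP => [i'|] ->.
  by rewrite lift_max ltn_ord (nth_map 0) ?size_tuple // -tnth_nth.
by rewrite ltnn eqxx.
Qed.

(** An entry a * l + y determines y modulo [l], and then a. Injectivity of row [i] on [S] recovers x
    from a, and x and y determine the column. *)
Lemma inflate_inj N (A : 'M[nat]_(N, k)) (i : 'I_N) (C : {set 'I_(l * k)})
    (S : {set 'I_k}) :
    col_base @: C \subset S -> {in S &, injective (A i)} ->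
  {in C &, injective (inflate A i)}.
Proof.
move=> /subsetP CS injA c d cC dC; rewrite !mxE => eq_cd; apply/val_inj => /=.
have /= eq_mod : c %% l = d %% l.
  by have := congr1 (modn^~ l) eq_cd; rewrite !modnMDl !modn_mod.
have eq_A : A i (col_base c) = A i (col_base d).
  move: eq_cd; rewrite eq_mod => /addIn/eqP.
  by rewrite eqn_pmul2r // => /eqP.
have /(congr1 val)/= eq_div : col_base c = col_base d.
  by apply: injA eq_A; apply/CS/imset_f.
by rewrite (divn_eq c l) eq_div eq_mod -divn_eq.
Qed.

Lemma inflate_perfect N t (A : 'M[nat]_(N, k)) (C : {set 'I_(l * k)}) :
    perfect t A -> #|col_base @: C| <= t <= k ->
  exists r, {in C &, injective (inflate A r)}.
Proof.
(* The x-coordinates may number fewer than [t], while [perfect] concerns sets of exactly [t]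
   columns; [t <= k] leaves room to enlarge. *)
move=> pA Ct; have [|S CS /pA[r inj_r]] := @superset_of_card _ (col_base @: C) t.
  by rewrite card_ord.
by exists r; apply: inflate_inj inj_r.
Qed.

Lemma size_undup_inflate N (v : N.-tuple nat) (A : 'M[nat]_(N, k)) i :
    HHF v A ->
  size (undup [seq inflate A i c | c : 'I_(l * k)]) <= l * tnth v i.
Proof.
move=> /(_ i) vA; pose s := undup [seq A i x | x : 'I_k].
(* Each entry pairs one of the symbols in [s] with one of [l] residues. *)
apply: (@leq_trans (size [seq a * l + y | a <- s, y <- iota 0 l])).
  apply: uniq_leq_size; first exact: undup_uniq.
  move=> a; rewrite mem_undup => /imageP[c _ ->]; rewrite mxE.
  apply: allpairs_f; last by rewrite mem_iota ltn_pmod.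
  by rewrite mem_undup; apply: image_f.
by rewrite size_allpairs size_iota mulnC leq_mul2l vA orbT.
Qed.

Lemma inflate_PHHF N t (v : N.-tuple nat) (A : 'M[nat]_(N, k)) :
  t <= k -> PHHF v t A -> PHHF (inflate_width v) t (inflate A).
Proof.
move=> tk /PHHFP[vA pA]; apply/PHHFP; split.
  by move=> i; rewrite tnth_mktuple; apply: size_undup_inflate.
move=> C Ct; apply: inflate_perfect pA _.
by rewrite tk -{1}Ct leq_imset_card.
Qed.

Lemma extend_PHHF N t (v : N.-tuple nat) (A : 'M[nat]_(N, k)) :
  t <= k -> PHHF v t A -> PHHF (extend_width v) t.+1 (extend A).
Proof.
move=> tk /PHHFP[vA pA]; apply/PHHFP; split.
  move=> i; rewrite tnth_mktuple (eq_image (fun=> erefl) (fun c => mxE _ _ i c)).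
  case: unliftP => [i' _|_]; first exact: size_undup_inflate.
  rewrite -[leqRHS](size_iota 0); apply: uniq_leq_size; first exact: undup_uniq.
  by move=> a; rewrite mem_undup => /imageP[c _ ->]; rewrite mem_iota ltn_ord.
move=> C Ct; have [injC|ninjC] := boolP (#|col_base @: C| == #|C|).
  exists ord_max => c d cC dC; rewrite !mxE unlift_none => /val_inj.
  exact: (imset_injP injC).
have [|r inj_r] := inflate_perfect (C := C) pA.
  (* A repeated x-coordinate leaves at most [t] of them among [t.+1] columns. *)
  by rewrite tk andbT -ltnS -Ct ltn_neqAle ninjC leq_imset_card.
by exists (lift ord_max r) => c d cC dC; rewrite !mxE liftK; apply: inj_r.
Qed.

Lemma row'_inflate N (A : 'M[nat]_(N, k)) j :
  row' j (inflate A) = inflate (row' j A).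
Proof. by apply/matrixP=> i c; rewrite !mxE. Qed.

Lemma delete_inflate_width N (v : N.-tuple nat) j :
  tuple_delete j (inflate_width v) = inflate_width (tuple_delete j v).
Proof. by apply: eq_from_tnth => i; rewrite !tnth_mktuple. Qed.

Lemma row'_max_extend N (A : 'M[nat]_(N, k)) :
  row' ord_max (extend A) = inflate A.
Proof. by apply/matrixP=> i c; rewrite !mxE liftK mxE. Qed.

Lemma delete_max_extend_width N (v : N.-tuple nat) :
  tuple_delete ord_max (extend_width v) = inflate_width v.
Proof. by apply: eq_from_tnth => i; rewrite !tnth_mktuple liftK. Qed.

(** Deleting a row other than the last keeps the last row last and renumbers the others as in the
    array without its last row. Hence deletion commutes with [extend]. *)
Lemma unlift_lift_max N (j : 'I_N.+1) (i : 'I_N.+1) :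
  unlift ord_max (lift (lift ord_max j) i) =
  omap (lift j) (unlift ord_max i).
Proof.
have bump_ord n (x : 'I_n) : bump n x = x by rewrite /bump leqNgt ltn_ord.
case: (unliftP ord_max i) => [i'|] -> /=.
  suff -> : lift (lift ord_max j) (lift ord_max i') = lift ord_max (lift j i').
    by rewrite liftK.
  by apply: val_inj; rewrite /= !bump_ord (bump_ord _ (lift j i')).
suff -> : lift (lift ord_max j) ord_max = ord_max :> 'I_N.+2.
  by rewrite unlift_none.
by apply: val_inj; rewrite /= bump_ord /bump -ltnS ltn_ord.
Qed.

Lemma row'_lift_extend N (A : 'M[nat]_(N.+1, k)) j :
  row' (lift ord_max j) (extend A) = extend (row' j A).
Proof.
apply/matrixP=> i c; rewrite !mxE unlift_lift_max.
by case: (unlift ord_max i) => //= i'; rewrite !mxE.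
Qed.

Lemma delete_lift_extend_width N (v : N.+1.-tuple nat) j :
  tuple_delete (lift ord_max j) (extend_width v) =
  extend_width (tuple_delete j v).
Proof.
apply: eq_from_tnth => i; rewrite !tnth_mktuple unlift_lift_max.
by case: (unlift ord_max i) => //= i'; rewrite tnth_mktuple.
Qed.

Lemma inflate_fractal t (v : t.+1.-tuple nat) (A : 'M[nat]_(t.+1, k)) :
  t < k -> fractal_PHHF v A -> fractal_PHHF (inflate_width v) (inflate A).
Proof.
elim: t => [|t IHt] in v A * => tk frA.
all: split; first by apply: inflate_PHHF => //; case: frA.
  by left.
right=> j; rewrite (minn_idPr (leqnSn _)) row'_inflate delete_inflate_width.
exact: IHt _ _ (ltnW tk) (fractal_PHHF_delete _ frA).
Qed.

Lemma extend_fractal t (v : t.+1.-tuple nat) (A : 'M[nat]_(t.+1, k)) :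
  t < k -> fractal_PHHF v A -> fractal_PHHF (extend_width v) (extend A).
Proof.
elim: t => [|t IHt] in v A * => tk frA.
all: split; first by apply: extend_PHHF => //; case: frA.
  by left.
right=> j; rewrite (minn_idPr (leqnSn _)); case: (unliftP ord_max j) => [j'|] ->.
  rewrite row'_lift_extend delete_lift_extend_width.
  exact: IHt _ _ (ltnW tk) (fractal_PHHF_delete _ frA).
(* Without its last row the array is [inflate A], whose fractality has its own induction. *)
by rewrite row'_max_extend delete_max_extend_width; apply: inflate_fractal.
Qed.

End Construction.

Theorem theorem14 (t k l : nat) (v : t.-tuple nat)
    (ht : 2 <= t) (hk : t < k) (hl : 1 <= l) :
  ((exists A : 'M[nat]_(t, k), PHHF v t A) ->
   exists B : 'M[nat]_(t.+1, l * k),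
     PHHF [tuple of rcons (map (muln l) v) k] t.+1 B)
  /\
  ((exists A : 'M[nat]_(t, k), fractal_PHHF v A) ->
   exists B : 'M[nat]_(t.+1, l * k),
     fractal_PHHF [tuple of rcons (map (muln l) v) k] B).
Proof.
split=> -[A hA]; exists (extend hl A); rewrite -extend_widthE.
  exact: extend_PHHF (ltnW hk) hA.
(* [extend_fractal] is stated for a successor number of rows; [ht] rules out zero. *)
by case: t => // t in v ht hk A hA *; apply: extend_fractal (ltnW hk) hA.
Qed.
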